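(* Let $\mathbb{K}$ be a field, $d\in\mathbb{N}$ and $R=\mathbb{K}[x_1,\dots,x_d]$. Let $h_1,\dots,h_r$ be hyperplanes with coefficients in $\mathbb{Q}_{\geqslant 0}^d$, and for each $\sigma\in\mathbb{Q}_+$ let $I_\sigma$ be the monomial ideal of $R$ determined by: a monomial $\underline{x}^{\underline{\alpha}}$ ($\underline{\alpha}\in\mathbb{N}^d$) belongs to $I_\sigma$ if and only if $h_i(\underline{\alpha})\geqslant\sigma$ for all $1\leqslant i\leqslant r$. Then there exist a monomial ideal $J$ of $R$ and a positive integer $g$ such that for every $\sigma\in\mathbb{Q}_+$ we have $I_\sigma=J^{\frac{\sigma}{g}}$.
   Context: $\mathbb{N}$ denotes the nonnegative integers and $\mathbb{Q}_+$ the positive rational numbers. A hyperplane with coefficients $\underline{a}\in\mathbb{Q}^d$ means here the linear function $h(\underline{X})=\underline{a}\cdot\underline{X}$ on $\mathbb{Q}^d$. For $\underline{\alpha}=(\alpha_1,\dots,\alpha_d)\in\mathbb{N}^d$, $\underline{x}^{\underline{\alpha}}=x_1^{\alpha_1}\cdots x_d^{\alpha_d}$. Rational powers: for an ideal $I$ of a commutative ring $A$ and $\frac{a}{b}\in\mathbb{Q}_+$ with $a,b$ positive integers, $I^{\frac{a}{b}}=\{x\in A \mid x^b\in\overline{I^a}\}$, where $\overline{\phantom{I}}$ denotes integral closure of ideals; this is an ideal depending only on the rational number $\frac{a}{b}$. *)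

(* Defs.v *)
From HB Require Import structures.
From mathcomp Require Import all_boot all_order all_algebra.
From mathcomp Require Import mpoly.

Set Implicit Arguments.
Unset Strict Implicit.
Unset Printing Implicit Defensive.

Import GRing.Theory Num.Theory.
Local Open Scope ring_scope.

(* Membership in a general ideal is not decidable, so ideals of A are predicates
   A -> Prop, compared extensionally. *)
Definition ideal_gen (A : comNzRingType) (G : A -> Prop) : A -> Prop :=
  fun x => exists (n : nat) (c g : 'I_n -> A),
    (forall i, G (g i)) /\ x = \sum_(i < n) c i * g i.

(* The empty product makes the power of exponent 0 the unit ideal. *)
Definition ideal_exp (A : comNzRingType) (I : A -> Prop) (n : nat) : A -> Prop :=
  ideal_gen (fun x => exists f : 'I_n -> A,
    (forall i, I (f i)) /\ x = \prod_(i < n) f i).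

(* Equations of integral dependence
   x ^ n + a_1 x ^ (n - 1) + ... + a_n = 0 with a_i in I ^ i. *)
Definition integral_closure (A : comNzRingType) (I : A -> Prop) : A -> Prop :=
  fun x => exists (n : nat) (a : nat -> A),
    [/\ (0 < n)%N,
        forall i, (1 <= i <= n)%N -> ideal_exp I i (a i) &
        x ^+ n + \sum_(1 <= i < n.+1) a i * x ^+ (n - i) = 0].

(* Only meant for q > 0. The set {x | x ^ b in the integral closure of I ^ a}
   depends only on the rational number q = a / b; it is taken here at the
   fraction in lowest terms, where denq q > 0. *)
Definition rational_power (A : comNzRingType) (I : A -> Prop) (q : rat) :
    A -> Prop :=
  fun x => integral_closure (ideal_exp I `|numq q|%N) (x ^+ `|denq q|%N).

Definition monomial_ideal (K : fieldType) (d : nat)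
    (I : {mpoly K[d]} -> Prop) : Prop :=
  exists S : 'X_{1..d} -> Prop, forall p,
    I p <-> ideal_gen (fun q => exists2 m, S m & q = 'X_[m]) p.

Definition hyperplane (d : nat) (a X : 'rV[rat]_d) : rat :=
  \sum_(j < d) a 0 j * X 0 j.

Definition exponent_vector (d : nat) (m : 'X_{1..d}) : 'rV[rat]_d :=
  \row_(j < d) (m j)%:R.

(* Main.v *)
Require Import Defs.
From Stdlib Require Import Classical.
From mathcomp Require Import all_boot all_order all_algebra.
From mathcomp Require Import mpoly zify.

Set Implicit Arguments.
Unset Strict Implicit.
Unset Printing Implicit Defensive.

Import Order.TTheory GRing.Theory Num.Theory.
Local Open Scope ring_scope.

(** Write I_n for the ideal of polynomials all of whose monomials m satisfy
    h_i(m) >= n for every i. The ideal J is I_g, for a g chosen such that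
    I_(g u) = I_g ^ u holds for every u. With sigma / g = u / v, so that
    g u = v sigma, this gives both inclusions.

    If p lies in I_sigma, then every monomial of p ^ v has h_i-weight at least
    v sigma = g u, so p ^ v lies in I_(g u) = J ^ u, and a fortiori in its
    integral closure.

    Conversely the least h_i-weight of a monomial of p behaves like a valuation:
    since a polynomial ring over a field is a domain, the part of lowest weight
    of p ^ k is the k-th power of that of p ([exp_min_weight]). An integral
    equation for p ^ v over J ^ u therefore forces the weight of p ^ v to be at
    least g u ([weight_ge_integral_closure]), and dividing by v
    ([weight_ge_root]) the weight of p is at least sigma.

    The existence of g is a statement about exponents. After clearing
    denominators the h_i have coefficients in nat, and the pairs (m, n) with
    n <= h_i(m) for all i form an affine semigroup, which is finitely generated
    (Gordan's lemma, [graded_cone_fin_gen], deduced from Dickson's lemma). The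
    degrees n of its elements are the powers in a Rees algebra, and a suitable
    Veronese subalgebra of a finitely generated graded algebra is generated in
    degree one; this is [graded_cone_veronese]. *)

(** * Dickson's lemma *)

(** The functions of [fs] are the coordinates. Stating the lemma for an arbitrary
    family of functions on a type, instead of for tuples, makes the induction on
    the number of coordinates immediate and lets the slack of an inequality serve
    as a coordinate.

    The induction hypothesis gives finitely many elements that dominate in all
    coordinates but the first one, [f]. They fail only for the x with [f x] below
    the maximum of [f] on them, that is on finitely many slices [f x = k], each
    of which is covered by the induction hypothesis again. *)
Lemma dickson (T : eqType) (fs : seq (T -> nat)) (P : T -> Prop) :
  exists s : seq T, (forall y, y \in s -> P y) /\
    forall x, P x -> exists2 y, y \in s & all (fun f => f y <= f x)%N fs.
Proof.
elim: fs P => [|f fs IH] P.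
  have [[x Px]|nP] := classic (exists x, P x).
    by exists [:: x]; split=> [y|y _]; [rewrite inE => /eqP-> | exists x; rewrite ?inE].
  by exists [::]; split=> // x Px; case: nP; exists x.
have [s [sP s_dom]] := IH P.
have slices k : exists t : seq T, (forall y, y \in t -> P y) /\
    forall x, P x -> (f x < k)%N ->
      exists2 y, y \in t & all (fun f => f y <= f x)%N (f :: fs).
  elim: k => [|k [t [tP t_dom]]]; first by exists [::].
  have [u [uP u_dom]] := IH (fun x => P x /\ f x = k).
  exists (t ++ u); split=> [y|x Px].
    by rewrite mem_cat => /orP[/tP | /uP[]].
  rewrite ltnS leq_eqVlt => /orP[/eqP fx|/(t_dom x Px)[y yt y_le]]; last first.
    by exists y; rewrite // mem_cat yt.
  have [y yu y_le] := u_dom x (conj Px fx).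
  have [_ fy] := uP y yu.
  by exists y; rewrite ?mem_cat ?yu ?orbT //= fx fy leqnn.
have [t [tP t_dom]] := slices (\max_(y <- s) f y)%N.
exists (s ++ t); split=> [y|x Px]; first by rewrite mem_cat => /orP[/sP|/tP].
have [max_le|lt_max] := leqP (\max_(y <- s) f y) (f x).
  have [y ys y_le] := s_dom x Px.
  exists y; rewrite ?mem_cat ?ys //= y_le andbT.
  by apply: leq_trans max_le; apply: leq_bigmax_seq.
by have [y yt y_le] := t_dom x Px lt_max; exists y; rewrite // mem_cat yt orbT.
Qed.

Lemma sum_incr_at (I : finType) (F c : I -> nat) (k0 : I) :
  (\sum_k F k * (c k + (k == k0)) = \sum_k F k * c k + F k0)%N.
Proof.
under eq_bigr do rewrite mulnDr.
rewrite big_split /= [X in (_ + X)%N](bigD1 k0) //= eqxx muln1.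
by rewrite [X in (_ + (_ + X))%N]big1 ?addn0 // => k /negPf->; rewrite muln0.
Qed.

(** * Finite generation of a graded cone *)

Definition linear_form d (b : 'I_d -> nat) (m : 'X_{1..d}) : nat :=
  (\sum_(j < d) b j * m j)%N.

Lemma linear_formD d (b : 'I_d -> nat) :
  {morph linear_form b : m1 m2 / (m1 + m2)%MM >-> (m1 + m2)%N}.
Proof.
move=> m1 m2; rewrite /linear_form -big_split; apply: eq_bigr => j _ /=.
by rewrite mnmDE mulnDr.
Qed.

Lemma linear_formMn d (b : 'I_d -> nat) m k :
  linear_form b (m *+ k)%MM = (linear_form b m * k)%N.
Proof.
by rewrite /linear_form big_distrl; apply: eq_bigr => j _; rewrite mulmnE mulnA.
Qed.

(** These (m, n) are the monomials x^m t^n of the Rees algebra of the filtration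
    n |-> (x^m | n <= h_i(m) for all i). *)
Definition graded_cone d r (A : 'I_r -> 'I_d -> nat) (m : 'X_{1..d}) (n : nat) :=
  forall i, (n <= linear_form (A i) m)%N.

Section GradedCone.

Variables (d r : nat) (A : 'I_r -> 'I_d -> nat).
Local Notation cone := (graded_cone A).

Lemma graded_coneD m1 n1 m2 n2 :
  cone m1 n1 -> cone m2 n2 -> cone (m1 + m2)%MM (n1 + n2).
Proof. by move=> c1 c2 i; rewrite linear_formD leq_add. Qed.

Lemma graded_coneMn m n k : cone m n -> cone (m *+ k)%MM (k * n).
Proof. by move=> c i; rewrite linear_formMn mulnC leq_mul2r c orbT. Qed.

Lemma graded_cone_sum (I : finType) (P : pred I) (m : I -> 'X_{1..d}) (n : I -> nat) :
  (forall k, P k -> cone (m k) (n k)) ->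
  cone (\big[+%MM/0%MM]_(k | P k) m k) (\sum_(k | P k) n k)%N.
Proof.
by move=> mn; apply: (big_ind2 cone) => //; [apply: graded_coneD].
Qed.

(** Gordan's lemma. The coordinates for Dickson's lemma are those of m, the degree
    n, and the slacks h_i(m) - n: domination in the slacks is what makes the
    difference of two elements belong to the cone, so that a generator can be
    subtracted from any nonzero element. *)
Lemma graded_cone_fin_gen : exists (N : nat) (m : 'I_N -> 'X_{1..d}) (n : 'I_N -> nat),
  (forall k, cone (m k) (n k)) /\
  forall m0 n0, cone m0 n0 -> exists c : 'I_N -> nat,
    m0 = \big[+%MM/0%MM]_k (m k *+ c k)%MM /\ n0 = (\sum_k c k * n k)%N.
Proof.
pose fs : seq ('X_{1..d} * nat -> nat) :=
  snd :: [seq (fun x : 'X_{1..d} * nat => x.1 j) | j <- index_enum 'I_d] ++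
  [seq (fun x : 'X_{1..d} * nat => linear_form (A i) x.1 - x.2)%N | i <- index_enum 'I_r].
have [s [sP s_dom]] := dickson fs (fun x => cone x.1 x.2 /\ x <> (0%MM, 0%N)).
pose x0 : 'X_{1..d} * nat := (0%MM, 0%N).
exists (size s), (fun k => (nth x0 s k).1), (fun k => (nth x0 s k).2); split=> [k|].
  by case: (sP (nth x0 s k) (mem_nth _ (ltn_ord k))).
move=> m0 n0; have [w] := ubnP (mdeg m0 + n0).
elim: w m0 n0 => // w IH m0 n0 le_w mn0.
have [[-> ->]|nz] := eqVneq (m0, n0) x0.
  exists (fun=> 0%N); split; last by rewrite big1.
  by rewrite big1 // => k _; rewrite mulm0n.
have [|[my ny] ys] := s_dom (m0, n0); first by split=> //; apply/eqP.
rewrite /fs /= all_cat !all_map /= => /and3P[le_n /allP le_m /allP le_sl].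
have [/= y_cone /eqP y_nz] := sP _ ys.
have le_ym : (my <= m0)%MM.
  by apply/mnm_lepP => j; apply: (le_m j); rewrite mem_index_enum.
have m0E := submK le_ym.
have [||c [mE nE]] := IH (m0 - my)%MM (n0 - ny)%N.
- have y_gt0 : (0 < mdeg my + ny)%N.
    rewrite lt0n; apply: contra y_nz; rewrite addn_eq0 mdeg_eq0.
    by case/andP=> /eqP-> /eqP->.
  by move: le_w (congr1 (@mdeg d) m0E); rewrite mdegD; lia.
- move=> i; move: (mn0 i) (y_cone i) (le_sl i (mem_index_enum _)).
  by move: (congr1 (linear_form (A i)) m0E); rewrite linear_formD /=; lia.
have lt_y : (index (my, ny) s < size s)%N by rewrite index_mem.
pose k0 := Ordinal lt_y.
exists (fun k => c k + (k == k0))%N; split.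
  apply/mnmP => j; rewrite -m0E mnmDE mE !mnm_sumE.
  under [RHS]eq_bigr do rewrite mulmnE.
  rewrite sum_incr_at /= nth_index //.
  by congr (_ + _)%N; apply: eq_bigr => k _; rewrite mulmnE.
under eq_bigr do rewrite mulnC.
rewrite sum_incr_at /= nth_index // -(subnK le_n) nE.
by congr (_ + _)%N; apply: eq_bigr => k _; rewrite mulnC.
Qed.

(** Any generator of positive degree has a multiple of degree exactly L, with L a
    common multiple of the degrees. An element of large degree contains one of
    these multiples, by the pigeonhole principle on its decomposition into
    generators. *)
Lemma graded_cone_peel : exists N L : nat, [/\ (0 < N)%N, (0 < L)%N &
  forall m n, (N * L <= n)%N -> cone m n ->
    exists m1 m2, [/\ m = (m1 + m2)%MM, cone m1 L & cone m2 (n - L)]].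
Proof.
have [N [ms [ns [gen_cone gen]]]] := graded_cone_fin_gen.
pose L := (\prod_k maxn 1 (ns k))%N.
have L_gt0 : (0 < L)%N by rewrite prodn_gt0 // => k; rewrite leq_max.
have dvd_L k : (0 < ns k)%N -> (ns k %| L)%N.
  by move=> nk; rewrite /L (bigD1 k) //= (maxn_idPr nk) dvdn_mulr.
(* One more than the number of generators, to have a strict inequality in the
   pigeonhole argument and a positive number when there are no generators. *)
exists N.+1, L; split=> // m n le_n /gen[c [mE nE]].
have /existsP[k le_k] : [exists k, L <= c k * ns k]%N.
  apply/contraLR: le_n => /existsPn lt_L; rewrite -ltnNge nE.
  have: (\sum_k c k * ns k <= N * L)%N.
    rewrite -[N in (N * _)%N]card_ord -sum_nat_const; apply: leq_sum => k _.
    by have := lt_L k; rewrite -ltnNge => /ltnW.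
  by rewrite mulSn; lia.
have nk : (0 < ns k)%N by case: (ns k) le_k => //; rewrite muln0 leqNgt L_gt0.
have LE := divnK (dvd_L k nk); set q := (L %/ ns k)%N in LE.
have le_q : (q <= c k)%N by rewrite -(leq_pmul2r nk) LE.
exists (ms k *+ q)%MM.
exists (ms k *+ (c k - q) + \big[+%MM/0%MM]_(l | l != k) (ms l *+ c l))%MM.
split.
- apply/mnmP => j; rewrite mE (bigD1 k) //= !mnmDE !mulmnE.
  by rewrite addnA -mulnDr subnKC.
- by rewrite -LE; apply: graded_coneMn.
have -> : (n - L = (c k - q) * ns k + \sum_(l | l != k) c l * ns l)%N.
  by rewrite nE (bigD1 k) //= -LE mulnBl addnBAC ?leq_mul2r ?le_q ?orbT.
apply: graded_coneD; first exact: graded_coneMn.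
by apply: graded_cone_sum => l _; apply: graded_coneMn.
Qed.

(** With g = N * L, splitting an element of degree D g u with u >= 2 is possible by
    peeling off D * N pieces of degree L: the degree stays at least D g all along,
    which leaves room for the next piece. The number D is the common denominator
    of the coefficients of the hyperplanes. *)
Lemma graded_cone_veronese D : (0 < D)%N -> exists2 g : nat, (0 < g)%N &
  forall u m, cone m (D * g * u) ->
    exists2 f : nat -> 'X_{1..d}, forall k, (k < u)%N -> cone (f k) (D * g) &
      (\big[+%MM/0%MM]_(k < u) f k <= m)%MM.
Proof.
move=> D_gt0; have [N [L [N_gt0 L_gt0 peel]]] := graded_cone_peel.
have peels t m n : ((N + t) * L <= n)%N -> cone m n ->
    exists m1 m2, [/\ m = (m1 + m2)%MM, cone m1 (t * L) & cone m2 (n - t * L)].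
  elim: t m n => [|t IH] m n le_n mn.
    by exists 0%MM, m; split; rewrite ?mul0n ?subn0 // ?(Monoid.mul1m +%MM).
  have [||m1 [m2 [-> c1 c2]]] := peel m n; [by nia | by [] |].
  have [||m3 [m4 [-> c3 c4]]] := IH m2 (n - L)%N; [by nia | by [] |].
  exists (m1 + m3)%MM, m4; split; first by rewrite addmA.
    by rewrite mulSn; apply: graded_coneD.
  by rewrite mulSn subnDA.
exists (N * L)%N; first by rewrite muln_gt0 N_gt0.
elim=> [|[|u] IH] m mn.
- by exists (fun=> 0%MM) => //; rewrite big_ord0; apply/mnm_lepP => j; rewrite mnm0E.
- by exists (fun=> m) => [k _|]; rewrite ?big_ord1 ?lepm_refl // -[(D * _)%N]muln1.
have [|m1 [m2 [-> c1 c2]]] := peels (D * N)%N m _ _ mn; first by nia.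
have [|f f_cone f_le] := IH m2.
  by move: c2; rewrite [X in cone _ X](_ : _ = D * (N * L) * u.+1)%N //; nia.
exists (fun k => if k is k'.+1 then f k' else m1).
  by case=> [_|k lt_k]; [rewrite mulnA | apply: f_cone].
rewrite big_ord_recl /=; apply/mnm_lepP => j; rewrite !mnmDE leq_add2l.
exact: (mnm_lepP f_le).
Qed.

End GradedCone.

(** * Ideals generated by monomials *)

Section GeneratedIdeals.

Variable A : comNzRingType.
Implicit Types (G : A -> Prop) (x y b : A).

Lemma ideal_gen_incl G x : G x -> ideal_gen G x.
Proof.
by move=> Gx; exists 1%N, (fun=> 1), (fun=> x); rewrite big_ord1 mul1r.
Qed.

Lemma ideal_gen0 G : ideal_gen G 0.
Proof. by exists 0%N, (fun=> 0), (fun=> 0); split=> [[]|] //; rewrite big_ord0. Qed.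

Lemma ideal_genD G x y : ideal_gen G x -> ideal_gen G y -> ideal_gen G (x + y).
Proof.
move=> [n [c [f [Gf ->]]]] [m [e [h [Gh ->]]]].
pose glue (u : 'I_n -> A) (v : 'I_m -> A) (k : 'I_(n + m)) :=
  match split k with inl i => u i | inr j => v j end.
have glueL u v i : glue u v (lshift m i) = u i by rewrite /glue (unsplitK (inl i)).
have glueR u v j : glue u v (rshift n j) = v j by rewrite /glue (unsplitK (inr j)).
exists (n + m)%N, (glue c e), (glue f h); split.
  by move=> k; rewrite /glue; case: split.
rewrite big_split_ord /=; congr (_ + _); apply: eq_bigr => k _.
  by rewrite !glueL.
by rewrite !glueR.
Qed.

Lemma ideal_genMl G b x : ideal_gen G x -> ideal_gen G (b * x).
Proof.
move=> [n [c [f [Gf ->]]]]; exists n, (fun i => b * c i), f; split=> //.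
by rewrite mulr_sumr; apply: eq_bigr => i _; rewrite mulrA.
Qed.

Lemma ideal_gen_integral G x : ideal_gen G x -> integral_closure (ideal_gen G) x.
Proof.
move=> Gx; exists 1%N, (fun=> - x); split=> // [i i1|].
  have -> : i = 1%N by lia.
  apply: ideal_gen_incl; exists (fun=> - x); rewrite big_ord1; split=> // _.
  by rewrite -mulN1r; apply: ideal_genMl.
by rewrite big_nat1 subnn expr1 expr0 mulr1 subrr.
Qed.

End GeneratedIdeals.

Lemma ideal_gen_monomials (K : fieldType) d (G : {mpoly K[d]} -> Prop) p :
  (forall m, m \in msupp p -> ideal_gen G 'X_[m]) -> ideal_gen G p.
Proof.
move=> Gp; rewrite [p]mpolyE big_seq.
apply: big_ind => [||m m_p]; [exact: ideal_gen0 | exact: ideal_genD |].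
by rewrite -mul_mpolyC; apply/ideal_genMl/Gp.
Qed.

(** Each monomial of a combination of monomials of I is divisible by one of them,
    hence lies in I. *)
Lemma monomial_idealP (K : fieldType) d (I : {mpoly K[d]} -> Prop) p :
  monomial_ideal I -> I p <-> forall m, m \in msupp p -> I 'X_[m].
Proof.
case=> S IS; split=> [/IS[n [c [f [Sf ->]]]] m | Ip]; last first.
  by apply/IS/ideal_gen_monomials => m /Ip/IS.
move/msupp_sum_le/flattenP => [_ /mapP[i _ ->]].
have [s Ss ->] := Sf i; rewrite (perm_mem (msuppMX _ _)) => /mapP[t _ ->].
rewrite addmC mpolyXD; apply/IS/ideal_genMl/ideal_gen_incl.
by exists s.
Qed.

Lemma ideal_exp_monomial (K : fieldType) d (I : {mpoly K[d]} -> Prop) u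
    (f : nat -> 'X_{1..d}) m :
  (forall k, (k < u)%N -> I 'X_[f k]) ->
  (\big[+%MM/0%MM]_(k < u) f k <= m)%MM -> ideal_exp I u 'X_[m].
Proof.
move=> If le_m; rewrite -(submK le_m) mpolyXD.
apply/ideal_genMl/ideal_gen_incl; exists (fun k => 'X_[f k]).
by split=> [k|]; [apply: If | rewrite (big_morph _ (mpolyXD K) (@mpolyX0 d K))].
Qed.

(** * Weight valuations *)

Section Weight.

Variables (K : fieldType) (d : nat) (a : 'rV[rat]_d).

Definition weight (m : 'X_{1..d}) : rat := hyperplane a (exponent_vector m).

Lemma weightE m : weight m = \sum_(j < d) a 0 j * (m j)%:R.
Proof. by apply: eq_bigr => j _; rewrite mxE. Qed.

Lemma weight0 : weight 0%MM = 0.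
Proof. by rewrite weightE big1 // => j _; rewrite mnm0E mulr0. Qed.

Lemma weightD m1 m2 : weight (m1 + m2)%MM = weight m1 + weight m2.
Proof.
rewrite !weightE -big_split; apply: eq_bigr => j _ /=.
by rewrite mnmDE natrD mulrDr.
Qed.

Implicit Types (p q : {mpoly K[d]}) (w : rat).

(** One predicate for the lower bounds, strict and not, and the homogeneity of the
    weights of a polynomial, so that sums and products are treated once. The zero
    polynomial satisfies all of them, as an element of infinite valuation. *)
Definition supp_weight (P : rat -> Prop) p :=
  forall m, m \in msupp p -> P (weight m).

Local Notation ge w := (supp_weight (fun x => w <= x)).
Local Notation gt w := (supp_weight (fun x => w < x)).

Lemma supp_weightM (P Q T : rat -> Prop) p q :
  (forall x y, P x -> Q y -> T (x + y)) ->
  supp_weight P p -> supp_weight Q q -> supp_weight T (p * q).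
Proof.
move=> PQ Pp Qq m /msuppM_le/allpairsP[[m1 m2] /= [/Pp P1 /Qq Q2 ->]].
by rewrite weightD; apply: PQ.
Qed.

Lemma supp_weight_eq1 : supp_weight (eq 0) 1.
Proof. by move=> m; rewrite msupp1 inE => /eqP->; rewrite weight0. Qed.

Lemma supp_weight0 P : supp_weight P 0.
Proof. by move=> m; rewrite msupp0. Qed.

Lemma supp_weightD P p q :
  supp_weight P p -> supp_weight P q -> supp_weight P (p + q).
Proof. by move=> Pp Pq m /msuppD_le; rewrite mem_cat => /orP[/Pp|/Pq]. Qed.

Lemma weight_eqX w p k :
  supp_weight (eq w) p -> supp_weight (eq (w *+ k)) (p ^+ k).
Proof.
move=> wp; elim: k => [|k IH]; first exact: supp_weight_eq1.
rewrite exprS; apply: (supp_weightM _ wp IH) => x y <- <-.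
by rewrite mulrS.
Qed.

Lemma weight_geM w1 w2 p q : ge w1 p -> ge w2 q -> ge (w1 + w2) (p * q).
Proof. by apply: supp_weightM => x y; apply: lerD. Qed.

Lemma weight_ge_prod w n (f : 'I_n -> {mpoly K[d]}) :
  (forall i, ge w (f i)) -> ge (w *+ n) (\prod_(i < n) f i).
Proof.
elim: n f => [|n IH] f wf.
  by rewrite big_ord0 => m /supp_weight_eq1 <-.
by rewrite big_ord_recl mulrS; apply/weight_geM/IH.
Qed.

Lemma weight_geX w p k : ge w p -> ge (w *+ k) (p ^+ k).
Proof.
by move=> wp; rewrite -[k in _ ^+ k]card_ord -prodr_const; apply: weight_ge_prod.
Qed.

Lemma supp_weight_sumX (r : seq 'X_{1..d}) (Q : pred 'X_{1..d}) c P :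
  (forall m, m \in r -> Q m -> P (weight m)) ->
  supp_weight P (\sum_(m <- r | Q m) c m *: 'X_[m] : {mpoly K[d]}).
Proof.
move=> QP; rewrite big_seq_cond.
apply: big_ind => [||m /andP[m_r Qm]]; [exact: supp_weight0 | exact: supp_weightD |].
by move=> m' /msuppZ_le; rewrite msuppX inE => /eqP->; apply: QP.
Qed.

Lemma min_weight_supp p m1 : m1 \in msupp p ->
  exists2 m0, m0 \in msupp p & ge (weight m0) p.
Proof.
rewrite /supp_weight; elim: (msupp p) m1 => // x [|y s] IH _ _.
  by exists x => [|z]; rewrite !inE // => /eqP->.
have [z z_s z_min] := IH _ (mem_head _ _).
have [le_xz|/ltW le_zx] := leP (weight x) (weight z).
  exists x; rewrite ?mem_head // => t; rewrite inE => /predU1P[->//|/z_min].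
  exact: le_trans.
by exists z => [|t]; rewrite inE ?z_s ?orbT // => /predU1P[->|/z_min].
Qed.

(** The weight is multiplicative on powers: split p into its part q of lowest weight
    and a rest of higher weight. Then p ^ k is q ^ k plus terms of higher weight,
    and q ^ k does not vanish in a domain. *)
Lemma exp_min_weight p m0 k : m0 \in msupp p -> ge (weight m0) p ->
  exists2 m, m \in msupp (p ^+ k) & weight m = weight m0 *+ k.
Proof.
set w := weight m0 => m0p min_p.
pose q := \sum_(m <- msupp p | weight m == w) p@_m *: 'X_[m] : {mpoly K[d]}.
pose r := \sum_(m <- msupp p | weight m != w) p@_m *: 'X_[m] : {mpoly K[d]}.
have pE : p = q + r by rewrite [LHS]mpolyE (bigID (fun m => weight m == w)).
have q_eq : supp_weight (eq w) q.
  by apply: supp_weight_sumX => m _ /eqP.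
have r_gt : gt w r.
  by apply: supp_weight_sumX => m /min_p; rewrite lt_neqAle eq_sym => -> ->.
have q_ge : ge w q by move=> m /q_eq <-.
have q_neq0 : q != 0.
  apply: contraL m0p => /eqP q0; apply/negP; rewrite pE q0 add0r => /r_gt.
  by rewrite ltxx.
have [s pkE s_gt] : exists2 s, p ^+ k = q ^+ k + s & gt (w *+ k) s.
  elim: (k) => [|j [s pjE s_gt]].
    by exists 0; [rewrite addr0 | apply: supp_weight0].
  exists (q * s + r * p ^+ j).
    by rewrite !exprS {1}pE mulrDl {1}pjE mulrDr addrA.
  rewrite mulrS; apply: supp_weightD.
    by apply: (supp_weightM _ q_ge s_gt) => x y; apply: ler_ltD.
  have pj_ge : ge (w *+ j) (p ^+ j) by apply: weight_geX.
  by apply: (supp_weightM _ r_gt pj_ge) => x y; apply: ltr_leD.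
have lead := mlead_supp (expf_neq0 k q_neq0).
have lead_w := weight_eqX q_eq lead.
exists (mlead (q ^+ k)) => //.
have lead_s : mlead (q ^+ k) \notin msupp s.
  by apply/negP => /s_gt; rewrite -lead_w ltxx.
by rewrite mcoeff_msupp pkE mcoeffD (memN_msupp_eq0 lead_s) addr0 -mcoeff_msupp.
Qed.

Lemma weight_ge_root w p n : (0 < n)%N -> ge (w *+ n) (p ^+ n) -> ge w p.
Proof.
move=> n_gt0 pn_w m mp.
have [m0 m0p min_p] := min_weight_supp mp.
have [m' m'p m'E] := exp_min_weight n m0p min_p.
apply: le_trans (min_p m mp).
by move: (pn_w m' m'p); rewrite m'E lerMn2r eqn0Ngt n_gt0.
Qed.

Hypothesis a_ge0 : forall j, 0 <= a 0 j.

Lemma weight_ge0 p : ge 0 p.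
Proof. by move=> m _; rewrite weightE sumr_ge0 // => j _; rewrite mulr_ge0. Qed.

(** Nonnegative coefficients enter here: multiplying a generator by an arbitrary
    polynomial cannot lower its weight. *)
Lemma weight_ge_ideal_gen (G : {mpoly K[d]} -> Prop) w p :
  (forall q, G q -> ge w q) -> ideal_gen G p -> ge w p.
Proof.
move=> Gw [n [c [f [Gf ->]]]].
apply: big_ind => [||i _]; [exact: supp_weight0 | exact: supp_weightD |].
by rewrite -[w]add0r; apply: weight_geM; [apply: weight_ge0 | apply: Gw].
Qed.

Lemma weight_ge_ideal_exp (I : {mpoly K[d]} -> Prop) w n p :
  (forall q, I q -> ge w q) -> ideal_exp I n p -> ge (w *+ n) p.
Proof.
move=> Iw; apply: weight_ge_ideal_gen => q [f [If ->]].
by apply: weight_ge_prod => i; apply: Iw.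
Qed.

(** If p had weight w0 < w, then in an equation of degree n each term
    c_i * p ^ (n - i) would have weight at least i w + (n - i) w0 > n w0, while
    p ^ n contains a monomial of weight exactly n w0. *)
Lemma weight_ge_integral_closure (I : {mpoly K[d]} -> Prop) w p :
  (forall q, I q -> ge w q) -> integral_closure I p -> ge w p.
Proof.
move=> Iw [n [c [n_gt0 Ic pE]]] m1 m1p; rewrite leNgt; apply/negP => lt_w.
have [m0 m0p min_p] := min_weight_supp m1p.
have w0 : weight m0 < w by apply: le_lt_trans lt_w; apply: min_p.
have [m mpn m_w] := exp_min_weight n m0p min_p.
have : gt (weight m0 *+ n) (p ^+ n).
  have -> : p ^+ n = \sum_(1 <= i < n.+1) - c i * p ^+ (n - i).
    apply/eqP; rewrite -subr_eq0 -sumrN -[X in _ == X]pE.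
    by under eq_bigr do rewrite mulNr opprK.
  rewrite big_nat.
  apply: big_ind => [||i /andP[i_gt0 le_i]]; [exact: supp_weight0 | exact: supp_weightD |].
  rewrite mulNr -mulrN; set j := (n - i)%N; have -> : n = (i + j)%N by lia.
  rewrite mulrnDr.
  apply: (@supp_weightM (fun x => w *+ i <= x) (fun x => weight m0 *+ j <= x)).
  - move=> x y wx; apply: ltr_leD; apply: lt_le_trans wx.
    by rewrite ltrMn2r i_gt0.
  - by apply: weight_ge_ideal_exp Iw _; apply: Ic; rewrite i_gt0.
  - by move=> t; rewrite (perm_mem (msuppN _)); apply: weight_geX.
by move/(_ m mpn); rewrite m_w ltxx.
Qed.

End Weight.

(** * The family of monomial ideals *)

Lemma common_denominator r d (a : 'I_r -> 'rV[rat]_d) :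
  (forall i j, 0 <= a i 0 j) ->
  exists (D : nat) (A : 'I_r -> 'I_d -> nat), (0 < D)%N /\
    forall i j, a i 0 j * D%:R = (A i j)%:R.
Proof.
move=> a_ge0; pose D := (\prod_i \prod_j `|denq (a i 0%R j)|)%N.
exists D, (fun i j => `|numq (a i 0%R j)| * (D %/ `|denq (a i 0%R j)|))%N.
split=> [|i j].
  by rewrite prodn_gt0 // => i; rewrite prodn_gt0 // => j; rewrite absz_gt0 denq_eq0.
have den_D : (`|denq (a i 0%R j)| %| D)%N.
  by rewrite /D (bigD1 i) //= (bigD1 j) //= -mulnA dvdn_mulr.
rewrite -{1}(divnK den_D) !natrM [_%:R * `|denq _|%N%:R]mulrC mulrA.
congr (_ * _); rewrite -[X in X * _]divq_num_den.
by rewrite !natr_absz !ger0_norm ?denq_ge0 ?numq_ge0 // divfK // intr_eq0 denq_eq0.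
Qed.

Lemma weight_linear_form d (a : 'rV[rat]_d) D (b : 'I_d -> nat) m :
  (forall j, a 0 j * D%:R = (b j)%:R) ->
  weight a m * D%:R = (linear_form b m)%:R.
Proof.
move=> ab; rewrite weightE mulr_suml natr_sum; apply: eq_bigr => j _.
by rewrite mulrAC ab natrM.
Qed.

Theorem theorem1 (K : fieldType) (d r : nat) (a : 'I_r -> 'rV[rat]_d)
    (a_ge0 : forall (i : 'I_r) (j : 'I_d), 0 <= a i 0 j)
    (I : rat -> {mpoly K[d]} -> Prop)
    (I_monomial : forall sigma : rat, 0 < sigma -> monomial_ideal (I sigma))
    (I_def : forall sigma : rat, 0 < sigma -> forall alpha : 'X_{1..d},
       I sigma 'X_[alpha] <->
       (forall i : 'I_r, sigma <= hyperplane (a i) (exponent_vector alpha))) :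
  exists (J : {mpoly K[d]} -> Prop) (g : nat),
    [/\ monomial_ideal J, (0 < g)%N &
        forall sigma : rat, 0 < sigma -> forall p : {mpoly K[d]},
          I sigma p <-> rational_power J (sigma / g%:R) p].
Proof.
have [D [A [D_gt0 aD]]] := common_denominator a_ge0.
have coneP m k : graded_cone A m (D * k) <-> forall i, k%:R <= weight (a i) m.
  have cone_i i : (D * k <= linear_form (A i) m)%N = (k%:R <= weight (a i) m).
    rewrite -(ler_nat rat) -(weight_linear_form m (aD i)) natrM mulrC.
    by rewrite ler_pM2r ?ltr0n.
  by split=> mk i; move: (mk i); rewrite cone_i.
have I_weight sigma p : 0 < sigma ->
    I sigma p <-> forall i, supp_weight (a i) (fun x => sigma <= x) p.
  move=> s_gt0; rewrite (monomial_idealP _ (I_monomial _ s_gt0)).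
  split=> [Ip i m /Ip/I_def|Ip m mp]; first exact.
  by apply/I_def => // i; apply: Ip.
have [g g_gt0 split_cone] := graded_cone_veronese A D_gt0.
have gR_gt0 : 0 < g%:R :> rat by rewrite ltr0n.
exists (I g%:R), g; split=> // [|sigma s_gt0 p]; first exact: I_monomial.
have q_gt0 : 0 < sigma / g%:R by rewrite divr_gt0.
rewrite /rational_power; set q := sigma / g%:R in q_gt0 *.
set u := `|numq q|%N; set v := `|denq q|%N.
have v_gt0 : (0 < v)%N by rewrite absz_gt0 denq_eq0.
have uvE : g%:R *+ u = sigma *+ v.
  have qE : q = u%:R / v%:R.
    by rewrite !natr_absz !ger0_norm ?denq_ge0 ?numq_ge0 ?divq_num_den // ltW.
  have vR : v%:R != 0 :> rat by rewrite pnatr_eq0 -lt0n.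
  have -> : sigma = g%:R * q by rewrite mulrC divfK // gt_eqF.
  by rewrite qE -[RHS]mulr_natr -mulrA divfK // mulr_natr.
split=> [/(I_weight _ _ s_gt0) p_weight | p_int].
  apply/ideal_gen_integral/ideal_gen_monomials => m mp.
  have /split_cone[f f_cone f_le] : graded_cone A m (D * g * u).
    rewrite -mulnA; apply/coneP => i; rewrite natrM mulr_natr uvE.
    exact: weight_geX (p_weight i) _ mp.
  by apply: (ideal_exp_monomial _ f_le) => k /f_cone/coneP/I_def; apply.
apply/I_weight => // i.
apply: (weight_ge_root v_gt0); rewrite -uvE.
apply: (weight_ge_integral_closure (a_ge0 i) _ p_int) => x.
apply: (weight_ge_ideal_exp (a_ge0 i)) => y.
by move/(I_weight _ _ gR_gt0)/(_ i).
Qed.
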